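(* Let $(W,S)$ be a Coxeter system, $s\in S$, and $n\ge 1$ an integer; let $\underline{n_s}=ss\cdots s$ ($n$ letters). Then $\tilde{\mathcal{R}}_{e,\underline{n_s}}(t)=F_n(t)$ and $\tilde{\mathcal{R}}_{s,\underline{n_s}}(t)=F_{n-1}(t)$.
   Context: Fibonacci polynomials: $F_0(v)=1$, $F_1(v)=v$, and $F_n(v)=vF_{n-1}(v)+F_{n-2}(v)$ for $n\ge 2$. Light leaves and diagrammatic polynomials: An $S$-graph is a finite planar graph with boundary in $\mathbb{R}\times[0,1]$, edges coloured by $S$, vertices either univalent (''dots'') or $2m_{st}$-valent ($m_{st}$ the order of $st$) with edges alternately coloured $s,t$; the top sequence is the word read on the top boundary; the degree is the number of dots. For a word $\underline{v}=s_1\cdots s_m$, the tree $\mathbb{T}_{\underline{v}}$ has root decorated by the empty diagram; a node of depth $k-1$ decorated by $D$ with top sequence a reduced expression $\underline{u}$ of $u\in W$ has: if $\ell(us_k)>\ell(u)$, two children ($D$ plus an $s_k$-coloured straight strand on the right, top $\underline{u}s_k$; $D$ plus an $s_k$ strand ending in a dot on the right, top $\underline{u}$, degree $+1$); if $\ell(us_k)<\ell(u)$, one child obtained by stacking $2m_{st}$-valent vertices on $D$ realizing braid moves from $\underline{u}$ to a reduced expression $\underline{u}''s_k$, then joining the rightmost top $s_k$ strand to a new $s_k$ strand from the bottom by an arc (top $\underline{u}''$, degree unchanged). The leaves are light leaves; $\mathbb{L}_{\underline{v}}(u)$ is the set of those whose top sequence is a reduced expression of $u$, and $\tilde{\mathcal{R}}_{u,\underline{v}}(t)=\sum_{l\in\mathbb{L}_{\underline{v}}(u)}t^{\deg(l)}$.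 *)

(* Defs.v *)
From HB Require Import structures.
From mathcomp Require Import all_boot all_order all_algebra.
From mathcomp Require Import boolp.
Set Implicit Arguments.
Unset Strict Implicit.
Unset Printing Implicit Defensive.
Import GRing.Theory.

Local Open Scope group_scope.

(* If x has infinite order, no m satisfies [order_is x m]. *)
Definition order_is (W : groupType) (x : W) (m : nat) : Prop :=
  [/\ (0 < m)%N, x ^+ m = 1 & forall k, (0 < k < m)%N -> x ^+ k <> 1].

(* The subset S of W is given by a type and its embedding in W.  The elements
   of S being involutions, products without inverses suffice for generation.
   [cox_universal] is the universal property of the group presented by the
   generators S and the relations (st)^(m_st) = 1, one for each pair s, t such
   that the order m_st of st is finite; uniqueness of the morphism follows from
   [cox_gen]. *)
Record coxeterSystem : Type := CoxeterSystem {
  cox_group :> groupType;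
  cox_S : Type;
  cox_elt : cox_S -> cox_group;
  cox_inj : injective cox_elt;
  cox_invol : forall s, order_is (cox_elt s) 2;
  cox_gen : forall w : cox_group,
    exists l : seq cox_S, \prod_(s <- l) cox_elt s = w;
  cox_universal : forall (G : groupType) (f : cox_S -> G),
    (forall s t m, order_is (cox_elt s * cox_elt t) m -> (f s * f t) ^+ m = 1) ->
    exists phi : cox_group -> G,
      {morph phi : x y / x * y} /\ forall s, phi (cox_elt s) = f s
}.

Section LightLeaves.
Variable C : coxeterSystem.
Local Notation S := (cox_S C).
Local Notation elt := (@cox_elt C).

Definition word_prod (l : seq S) : C := \prod_(s <- l) elt s.

Lemma ell_subproof (w : C) :
  exists n : nat, `[< exists2 l : seq S, word_prod l = w & size l = n >].
Proof. by have [l lw] := cox_gen w; exists (size l); apply/asboolP; exists l. Qed.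

Definition ell (w : C) : nat := ex_minn (ell_subproof w).

Definition reduced_expr (l : seq S) (w : C) : Prop :=
  word_prod l = w /\ size l = ell w.

Definition alt_word (m : nat) (s t : S) : seq S :=
  mkseq (fun i => if odd i then t else s) m.

(* S-graphs in the strip, presented by cutting them into elementary pieces put
   side by side or stacked.  [Beside D E] has E on the right of D, and
   [Stack D E] has E above D.  [DotUp s] is an s-strand going up from the bottom
   and ending in a dot, [DotDown s] one going down from the top; [Cap s] and
   [Cup s] are arcs with both ends on the bottom, resp. on the top.
   [Vertex m s t] is the 2m-valent vertex with m edges below, coloured s, t, ...
   from left to right, and m edges above, coloured t, s, ...; any other position
   of its edges is obtained, up to isotopy, by composing with arcs. *)
Inductive sgraph : Type :=
| Strands of seq S
| DotUp of S
| DotDown of S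
| Cap of S
| Cup of S
| Vertex of nat & S & S
| Beside of sgraph & sgraph
| Stack of sgraph & sgraph.

Fixpoint bottom_seq (D : sgraph) : seq S :=
  match D with
  | Strands l => l
  | DotUp s => [:: s]
  | DotDown _ => [::]
  | Cap s => [:: s; s]
  | Cup _ => [::]
  | Vertex m s t => alt_word m s t
  | Beside D E => bottom_seq D ++ bottom_seq E
  | Stack D _ => bottom_seq D
  end.

Fixpoint top_seq (D : sgraph) : seq S :=
  match D with
  | Strands l => l
  | DotUp _ => [::]
  | DotDown s => [:: s]
  | Cap _ => [::]
  | Cup s => [:: s; s]
  | Vertex m s t => alt_word m t s
  | Beside D E => top_seq D ++ top_seq E
  | Stack _ E => top_seq E
  end.

Fixpoint degree (D : sgraph) : nat :=
  match D with
  | DotUp _ | DotDown _ => 1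
  | Beside D E | Stack D E => degree D + degree E
  | _ => 0
  end.

(* The pieces match along every cut, and the 2m-valent vertices are those
   allowed by the Coxeter system. *)
Fixpoint well_formed (D : sgraph) : Prop :=
  match D with
  | Vertex m s t => s <> t /\ order_is (elt s * elt t) m
  | Beside D E => well_formed D /\ well_formed E
  | Stack D E => [/\ well_formed D, well_formed E & top_seq D = bottom_seq E]
  | _ => True
  end.

(* [braid_stack D D'] : D' is D with finitely many 2m-valent vertices stacked
   on it, each realizing a braid move of the current top sequence. *)
Inductive braid_stack (D : sgraph) : sgraph -> Prop :=
| BraidRefl : braid_stack D D
| BraidStep (D' : sgraph) (p q : seq S) (m : nat) (s t : S) :
    braid_stack D D' -> s <> t -> order_is (elt s * elt t) m ->
    top_seq D' = p ++ alt_word m s t ++ q ->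
    braid_stack D
      (Stack D' (Beside (Strands p) (Beside (Vertex m s t) (Strands q)))).

Definition add_strand (D : sgraph) (s : S) : sgraph := Beside D (Strands [:: s]).

Definition add_dot (D : sgraph) (s : S) : sgraph := Beside D (DotUp s).

(* For D with top sequence [rcons l s]. *)
Definition add_arc (D : sgraph) (l : seq S) (s : S) : sgraph :=
  Stack (add_strand D s) (Beside (Strands l) (Cap s)).

Inductive dtree : Type :=
| Leaf of sgraph
| Node1 of sgraph & dtree
| Node2 of sgraph & dtree & dtree.

(* [ll_tree_from D v T] : T is the part, rooted at a node decorated by D, of a
   tree of light leaves in which the letters v remain to be read.  The braid
   moves are not determined by the word, so there may be several such trees. *)
Inductive ll_tree_from : sgraph -> seq S -> dtree -> Prop :=
| LLLeaf D : ll_tree_from D [::] (Leaf D)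
| LLUp D s v T1 T2 :
    (ell (word_prod (top_seq D)) < ell (word_prod (top_seq D) * elt s))%N ->
    ll_tree_from (add_strand D s) v T1 ->
    ll_tree_from (add_dot D s) v T2 ->
    ll_tree_from D (s :: v) (Node2 D T1 T2)
| LLDown D D' l s v T :
    (ell (word_prod (top_seq D) * elt s) < ell (word_prod (top_seq D)))%N ->
    braid_stack D D' -> top_seq D' = rcons l s ->
    ll_tree_from (add_arc D' l s) v T ->
    ll_tree_from D (s :: v) (Node1 D T).

Definition light_leaves_tree (v : seq S) (T : dtree) : Prop :=
  ll_tree_from (Strands [::]) v T.

Fixpoint leaves (T : dtree) : seq sgraph :=
  match T with
  | Leaf D => [:: D]
  | Node1 _ T1 => leaves T1
  | Node2 _ T1 T2 => leaves T1 ++ leaves T2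
  end.

(* For T a tree of light leaves of the word v, the polynomial attached to u
   and v.  Distinct leaves of T are distinct S-graphs (where their branches
   separate, the same bottom edge ends in a dot in exactly one of them), so
   this is also the sum over the set of these S-graphs. *)
Definition Rtilde (T : dtree) (u : C) : {poly int} :=
  (\sum_(l <- leaves T | `[< reduced_expr (top_seq l) u >]) 'X^(degree l))%R.

End LightLeaves.

Fixpoint fib_poly (n : nat) : {poly int} :=
  match n with
  | 0 => 1%R
  | n'.+1 => match n' with
             | 0 => 'X%R
             | n''.+1 => ('X * fib_poly n' + fib_poly n'')%R
             end
  end.

Section Sanity.
Variable C : coxeterSystem.

Lemma braid_stack_wf (D D' : sgraph C) : braid_stack D D' -> well_formed D ->
  well_formed D' /\ bottom_seq D' = bottom_seq D.
Proof.
elim=> [//|D1 p q m s t _ IH st om tD wD].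
by have [w1 b1] := IH wD; split.
Qed.

Fixpoint all_leaves (P : sgraph C -> Prop) (T : dtree C) : Prop :=
  match T with
  | Leaf D => P D
  | Node1 _ T1 => all_leaves P T1
  | Node2 _ T1 T2 => all_leaves P T1 /\ all_leaves P T2
  end.

Lemma ll_tree_from_wf D v T : ll_tree_from D v T -> well_formed D ->
  all_leaves (fun l => well_formed l /\ bottom_seq l = bottom_seq D ++ v) T.
Proof.
elim=> {D v T} [D wD|D s v T1 T2 _ _ IH1 _ IH2 wD|D D' l s v T _ bD tD _ IH wD] /=.
- by rewrite cats0.
- by move: IH1 IH2; rewrite /= -catA => IH1 IH2; split; [apply: IH1|apply: IH2].
- have [w1 b1] := braid_stack_wf bD wD.
  by move: IH; rewrite /= b1 -catA; apply; do 2?split => //; rewrite tD cat_rcons.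
Qed.

Lemma ll_tree_wf v T : light_leaves_tree v T ->
  all_leaves (fun l : sgraph C => well_formed l /\ bottom_seq l = v) T.
Proof. by move=> /ll_tree_from_wf; apply. Qed.

Lemma ell1 : ell (1 : C) = 0%N.
Proof.
rewrite /ell; case: ex_minnP => n _ min_n; apply/eqP; rewrite -leqn0; apply: min_n.
by apply/asboolP; exists [::] => //; rewrite /word_prod big_nil.
Qed.

Lemma ell_elt (s : cox_S C) : ell (cox_elt s) = 1%N.
Proof.
rewrite /ell; case: ex_minnP => n /asboolP[l ls <-] min_n; apply/eqP.
rewrite eqn_leq; apply/andP; split.
  by apply: min_n; apply/asboolP; exists [:: s] => //; rewrite /word_prod big_seq1.
case: l ls {min_n} => // ls; case: (cox_invol s) => _ _ /(_ 1%N isT) [].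
by rewrite -ls /word_prod big_nil.
Qed.

Lemma ll_tree_nseq_from (s : cox_S C) n D :
  top_seq D = [::] \/ top_seq D = [:: s] ->
  exists T, ll_tree_from D (nseq n s) T.
Proof.
have ss : cox_elt s * cox_elt s = 1 by case: (cox_invol s).
elim: n D => [|n IH] D tD; first by exists (Leaf D); constructor.
case: tD => tD.
- have [|T1 h1] := IH (add_strand D s); first by right; rewrite /= tD.
  have [|T2 h2] := IH (add_dot D s); first by left; rewrite /= tD.
  exists (Node2 D T1 T2); constructor => //.
  by rewrite tD /word_prod big_nil mul1g ell1 ell_elt.
- have [|T h] := IH (add_arc D [::] s); first by left.
  exists (Node1 D T); apply: (LLDown (D' := D) (l := [::])) => //.
    by rewrite tD /word_prod big_seq1 ss ell1 ell_elt.
  exact: BraidRefl.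
Qed.

Lemma ll_tree_nseq_exists (s : cox_S C) n :
  exists T, light_leaves_tree (nseq n s) T.
Proof. by apply: ll_tree_nseq_from; left. Qed.

End Sanity.

(* Main.v *)
(* While the word [s ... s] is read, every node of a tree of light leaves has top
   sequence [::] or [:: s]: a braid move needs at least two strands.  A node with
   top [::] has a child with top [:: s] and, with one more dot, a child with top
   [::]; a node with top [:: s] has a single child, with top [::].  This
   branching is the Fibonacci recursion. *)

Require Import Defs.
From mathcomp Require Import all_boot all_order all_algebra.
From mathcomp Require Import boolp ring.

Set Implicit Arguments.
Unset Strict Implicit.
Unset Printing Implicit Defensive.
Import GRing.Theory.

Local Open Scope ring_scope.

(* The Fibonacci polynomial of index n - 1, extended by 0 to the index -1. *)
Definition fib_poly_pred (n : nat) : {poly int} :=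
  if n is m.+1 then fib_poly m else 0.

Lemma fib_polyS n : fib_poly n.+1 = 'X * fib_poly n + fib_poly_pred n.
Proof. by case: n => //=; rewrite mulr1 addr0. Qed.

Section LightLeavesPower.
Variable C : coxeterSystem.
Implicit Types (s t : cox_S C) (D : sgraph C) (T : dtree C).

Lemma cox_elt_neq1 s : cox_elt s <> 1%g.
Proof. by case: (cox_invol s) => _ _ /(_ 1%N isT). Qed.

Lemma cox_elt_sq s : (cox_elt s * cox_elt s = 1)%g.
Proof. by case: (cox_invol s). Qed.

(** Order 1 would give $st = 1 = tt$, whence $s = t$ by injectivity of [cox_elt]. *)
Lemma order_is_gt1 s t m :
  s <> t -> order_is (cox_elt s * cox_elt t)%g m -> (1 < m)%N.
Proof.
move=> st [m_gt0 stm _]; case: m m_gt0 stm => [|[|m]] // _; rewrite expg1 => st1.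
case: st; apply: cox_inj.
by rewrite -[LHS]mulg1 -(cox_elt_sq t) mulgA st1 mul1g.
Qed.

Lemma braid_stack_small D D' :
  braid_stack D D' -> (size (top_seq D) <= 1)%N -> D' = D.
Proof.
elim=> [//|D1 p q m s t _ IH st om tD sD].
have eqD := IH sD.
(* The move rewrites a factor of length $m \ge 2$ in a word of at most one letter: this case is
   void. *)
have := order_is_gt1 st om; move: sD; rewrite -eqD tD !size_cat size_mkseq.
by rewrite addnCA => /(leq_trans (leq_addr _ _)) m1; rewrite ltnNge m1.
Qed.

Lemma reduced_expr_nil (u : C) : reduced_expr [::] u <-> u = 1%g.
Proof.
rewrite /reduced_expr /word_prod big_nil.
by split=> [[]|->] //; rewrite ell1.
Qed.

Lemma reduced_expr_seq1 s (u : C) : reduced_expr [:: s] u <-> u = cox_elt s.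
Proof.
rewrite /reduced_expr /word_prod big_seq1.
by split=> [[]|->] //; rewrite ell_elt.
Qed.

Lemma Rtilde_Leaf D u :
  Rtilde (Leaf D) u = if `[< reduced_expr (top_seq D) u >] then 'X^(degree D) else 0.
Proof. by rewrite /Rtilde /= big_mkcond big_seq1. Qed.

Lemma Rtilde_Node1 D T u : Rtilde (Node1 D T) u = Rtilde T u.
Proof. by []. Qed.

Lemma Rtilde_Node2 D T1 T2 u :
  Rtilde (Node2 D T1 T2) u = Rtilde T1 u + Rtilde T2 u.
Proof. exact: big_cat. Qed.

Lemma ll_tree_from_nilE D T : ll_tree_from D [::] T -> T = Leaf D.
Proof. by move=> h; inversion h. Qed.

Lemma ll_tree_from_top_nilE D s v T :
  top_seq D = [::] -> ll_tree_from D (s :: v) T ->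
  exists T1 T2, [/\ T = Node2 D T1 T2, ll_tree_from (add_strand D s) v T1
                  & ll_tree_from (add_dot D s) v T2].
Proof.
move=> tD h; inversion h as [|? ? ? T1 T2 _ h1 h2|? ? ? ? ? ? lt_ell]; subst.
  by exists T1, T2.
(* [LLDown] would need an element shorter than the identity. *)
by move: lt_ell; rewrite tD /word_prod big_nil ell1.
Qed.

Lemma ll_tree_from_top_seq1E D s v T :
  top_seq D = [:: s] -> ll_tree_from D (s :: v) T ->
  exists2 T', T = Node1 D T' & ll_tree_from (add_arc D [::] s) v T'.
Proof.
move=> tD h.
inversion h as [|? ? ? ? ? lt_ell|? D' l ? ? T' _ bD tD' hT]; subst.
  (* [LLUp] is excluded because $ss = 1$ has length 0. *)
  by move: lt_ell; rewrite tD /word_prod big_seq1 cox_elt_sq ell1.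
have eqD : D' = D by apply: braid_stack_small bD _; rewrite tD.
move: tD' hT; rewrite {}eqD tD; case: l => [_ hT|x [|y l]] //.
by exists T'.
Qed.

(* The difference in the last equation is the Fibonacci polynomial of index
   n - 2, extended by 1 to the index -2. *)
Lemma Rtilde_nseq_from s n D T : ll_tree_from D (nseq n s) T ->
  (top_seq D = [::] ->
     Rtilde T 1%g = 'X^(degree D) * fib_poly n /\
     Rtilde T (cox_elt s) = 'X^(degree D) * fib_poly_pred n) /\
  (top_seq D = [:: s] ->
     Rtilde T 1%g = 'X^(degree D) * fib_poly_pred n /\
     Rtilde T (cox_elt s) =
       'X^(degree D) * (fib_poly n - 'X * fib_poly_pred n)).
Proof.
have s1 := @cox_elt_neq1 s.
elim: n D T => [|n IH] D T.
  move=> /ll_tree_from_nilE ->; rewrite !Rtilde_Leaf /=.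
  (* The single leaf counts only for the element spelled by its top sequence; [s1] keeps the two
     elements apart. *)
  split=> ->; split; case: asboolP => h; rewrite ?mulr0 ?subr0 ?mulr1 //.
  - by case: h; apply/reduced_expr_nil.
  - by move/reduced_expr_nil: h.
  - by move/reduced_expr_seq1: h => /esym.
  - by case: h; apply/reduced_expr_seq1.
move=> hT; split=> tD.
  have [T1 [T2 [-> h1 h2]]] := ll_tree_from_top_nilE tD hT.
  have tD1 : top_seq (add_strand D s) = [:: s] by rewrite /= tD.
  have tD2 : top_seq (add_dot D s) = [::] by rewrite /= tD.
  have [_ /(_ tD1)[R1 Rs]] := IH _ _ h1.
  have [/(_ tD2)[R1' Rs'] _] := IH _ _ h2.
  (* The extra dot of [T2] gives a factor ['X]. For $s$, its contribution cancels the term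
     ['X * fib_poly_pred n] subtracted in that of [T1]. *)
  rewrite !Rtilde_Node2 R1 Rs R1' Rs' fib_polyS /= addn0 addn1 exprSr.
  by split; ring.
have [T' -> h] := ll_tree_from_top_seq1E tD hT.
have [/(_ erefl)[R1 Rs] _] := IH _ _ h.
rewrite !Rtilde_Node1 R1 Rs fib_polyS /= !addn0.
by split=> //; ring.
Qed.

End LightLeavesPower.

Theorem theorem4p3 (C : coxeterSystem) (s : cox_S C) (n : nat) (T : dtree C) :
  (1 <= n)%N ->
  light_leaves_tree (nseq n s) T ->
  Rtilde T 1%g = fib_poly n /\ Rtilde T (cox_elt s) = fib_poly n.-1.
Proof.
(* The root is the empty diagram: empty top sequence, degree 0. For a positive index,
   [fib_poly_pred] is a true Fibonacci polynomial. *)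
case: n => // n _ /Rtilde_nseq_from[/(_ erefl)[-> ->] _].
by rewrite !mul1r.
Qed.
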